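(* Let $M$ be a domain in $H^3$ (upper half space model, coordinates $(x,y,z)$, $z>0$), and let $\sigma$ be a horospherical unit vector field on $M$, expressed in standard form $$\sigma=\cos u\,\xi_1+\sin u\,\xi_2,$$ where $u$ is a smooth locally defined real-valued function. Then the bending of $\sigma$ is $$|\nabla\sigma|^2=1+|\nabla u|^2,$$ and $\sigma$ is harmonic if and only if the following two equations hold: $$\Delta u=0,$$ $$u_x\sin u=u_y\cos u,$$ where $\Delta$ is the hyperbolic Laplacian, and $u_x=\partial u/\partial x$, $u_y=\partial u/\partial y$.
   Context: $H^3=\{(x,y,z):z>0\}$ with metric $ds^2=(dx^2+dy^2+dz^2)/z^2$; $\nabla$ is the Levi-Civita connection (and $\nabla u$ the gradient), and norms are taken with respect to the hyperbolic metric. The standard orthonormal frame is $\xi_1=z\,\partial_x$, $\xi_2=z\,\partial_y$, $\xi_3=z\,\partial_z$. A unit vector field is horospherical if it is tangent to a foliation by horospheres, here the standard foliation with leaves $z=\text{const.}$ A smooth unit vector field $\sigma$ is harmonic if $\nabla^*\nabla\sigma=|\nabla\sigma|^2\sigma$, where $\nabla^*\nabla=-\mathrm{Tr}\,\nabla^2$; $|\nabla\sigma|^2$ is called the bending of $\sigma$. The hyperbolic Laplacian $\Delta u=-\mathrm{div}(\nabla u)$ is given by $-\Delta u=z^2(u_{xx}+u_{yy}+u_{zz})-z\,u_z$. *)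

(* Defs.v *)
(* Points of R^3 and vector fields on it are row vectors
   'rV[R]_3; vector fields are given by their components in the coordinate
   basis (d/dx, d/dy, d/dz), and the coordinates x, y, z have indices 0, 1, 2. *)
From HB Require Import structures.
From mathcomp Require Import all_boot all_order all_algebra.
From mathcomp Require Import all_classical all_reals all_analysis.

Set Implicit Arguments.
Unset Strict Implicit.
Unset Printing Implicit Defensive.

Import Order.TTheory GRing.Theory Num.Theory.
Import numFieldNormedType.Exports.

Local Open Scope classical_set_scope.
Local Open Scope ring_scope.

Definition coord_vec {R : realType} (i : 'I_3) : 'rV[R]_3 := delta_mx 0 i.

Definition partial {R : realType} (i : 'I_3) (f : 'rV[R]_3 -> R) :
    'rV[R]_3 -> R :=
  fun p => 'D_(coord_vec i) f p.

Definition iter_partial {R : realType} (s : seq 'I_3) (f : 'rV[R]_3 -> R) :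
    'rV[R]_3 -> R :=
  foldr partial f s.

(* C^oo on an open set: the iterated partial derivatives of every order exist
   and are continuous.  The existence clause is needed because 'D_v f p is a
   total operator. *)
Definition smooth_on {R : realType} (U : set 'rV[R]_3) (f : 'rV[R]_3 -> R) :=
  forall (s : seq 'I_3) (p : 'rV[R]_3), U p ->
    {for p, continuous (iter_partial s f)} /\
    (forall i, derivable (iter_partial s f) p (coord_vec i)).

Definition smooth_field_on {R : realType} (U : set 'rV[R]_3)
    (X : 'rV[R]_3 -> 'rV[R]_3) :=
  forall k, smooth_on U (fun p => X p 0 k).

Definition H3 {R : realType} : set 'rV[R]_3 := [set p | 0 < p 0 2].

Definition is_domain {R : realType} (M : set 'rV[R]_3) :=
  [/\ M `<=` H3, open M, connected M & M !=set0].

Definition hyp_metric {R : realType} (p : 'rV[R]_3) : 'M[R]_3 :=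
  ((p 0 2) ^- 2)%:M.

Definition hyp_inner {R : realType} (p v w : 'rV[R]_3) : R :=
  \sum_i \sum_j hyp_metric p i j * v 0 i * w 0 j.

Definition hyp_sqnorm {R : realType} (p v : 'rV[R]_3) : R := hyp_inner p v v.

(* christoffel k i j is Gamma^k_{ij}. *)
Definition christoffel {R : realType} (k i j : 'I_3) (p : 'rV[R]_3) : R :=
  2^-1 * \sum_l invmx (hyp_metric p) k l *
    (partial i (fun q => hyp_metric q j l) p +
     partial j (fun q => hyp_metric q i l) p -
     partial l (fun q => hyp_metric q i j) p).

(* cov_deriv X Y is the Levi-Civita covariant derivative of Y along X. *)
Definition cov_deriv {R : realType} (X Y : 'rV[R]_3 -> 'rV[R]_3) :
    'rV[R]_3 -> 'rV[R]_3 :=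
  fun p => \row_k \sum_i X p 0 i *
    (partial i (fun q => Y q 0 k) p + \sum_j christoffel k i j p * Y p 0 j).

Definition cov_deriv2 {R : realType} (X Y Z : 'rV[R]_3 -> 'rV[R]_3) :
    'rV[R]_3 -> 'rV[R]_3 :=
  fun p => cov_deriv X (cov_deriv Y Z) p - cov_deriv (cov_deriv X Y) Z p.

(* The standard frame, orthonormal for hyp_metric on H3; the metric traces
   below are sums over it. *)
Definition xi {R : realType} (i : 'I_3) : 'rV[R]_3 -> 'rV[R]_3 :=
  fun p => p 0 2 *: coord_vec i.

Definition rough_laplacian {R : realType} (X : 'rV[R]_3 -> 'rV[R]_3) :
    'rV[R]_3 -> 'rV[R]_3 :=
  fun p => - \sum_i cov_deriv2 (xi i) (xi i) X p.

Definition bending {R : realType} (X : 'rV[R]_3 -> 'rV[R]_3)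
    (p : 'rV[R]_3) : R :=
  \sum_i hyp_sqnorm p (cov_deriv (xi i) X p).

Definition hyp_grad {R : realType} (u : 'rV[R]_3 -> R) :
    'rV[R]_3 -> 'rV[R]_3 :=
  fun p => \row_k \sum_j invmx (hyp_metric p) k j * partial j u p.

Definition hyp_div {R : realType} (X : 'rV[R]_3 -> 'rV[R]_3)
    (p : 'rV[R]_3) : R :=
  \sum_i hyp_inner p (cov_deriv (xi i) X p) (xi i p).

(* Sign convention of a nonnegative operator. *)
Definition hyp_laplacian {R : realType} (u : 'rV[R]_3 -> R)
    (p : 'rV[R]_3) : R :=
  - hyp_div (hyp_grad u) p.

Definition smooth_unit_field {R : realType} (M : set 'rV[R]_3)
    (sigma : 'rV[R]_3 -> 'rV[R]_3) :=
  smooth_field_on M sigma /\ (forall p, M p -> hyp_sqnorm p (sigma p) = 1).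

(* Tangency to the horospheres z = const, i.e. dz(sigma) = 0. *)
Definition horospherical_unit_field {R : realType} (M : set 'rV[R]_3)
    (sigma : 'rV[R]_3 -> 'rV[R]_3) :=
  smooth_unit_field M sigma /\ (forall p, M p -> sigma p 0 2 = 0).

Definition harmonic_unit_field {R : realType} (M : set 'rV[R]_3)
    (sigma : 'rV[R]_3 -> 'rV[R]_3) :=
  smooth_unit_field M sigma /\
  (forall p, M p -> rough_laplacian sigma p = bending sigma p *: sigma p).

(* u i is a smooth angle function of sigma on the open set U i; the sets U i
   cover M.  A single global angle is the case where the index type is unit. *)
Definition standard_form {R : realType} (M : set 'rV[R]_3)
    (sigma : 'rV[R]_3 -> 'rV[R]_3) (I : Type)
    (U : I -> set 'rV[R]_3) (u : I -> 'rV[R]_3 -> R) :=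
  [/\ M = \bigcup_i U i,
      forall i, open (U i),
      forall i, smooth_on (U i) (u i) &
      forall i p, U i p ->
        sigma p = cos (u i p) *: xi 0 p + sin (u i p) *: xi 1 p].

(* Main.v *)
Require Import Defs.
From HB Require Import structures.
From mathcomp Require Import all_boot all_order all_algebra.
From mathcomp Require Import all_classical all_reals all_analysis.
From mathcomp Require Import ring.

Set Implicit Arguments.
Unset Strict Implicit.
Unset Printing Implicit Defensive.

Import Order.TTheory GRing.Theory Num.Theory.
Import numFieldNormedType.Exports.
Local Open Scope classical_set_scope.
Local Open Scope ring_scope.

(** Everything is computed in the orthonormal frame xi_i = z d/dx_i, in which
    the connection has constant coefficients.  If Y has frame components y_k,
    the conformal factor cancels the Christoffel symbols down to
      (nabla_{xi_i} Y)_k = z d_i y_k - [i = k] y_z + [k = z] y_i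
    (cov_deriv_frame), and the metric becomes the Euclidean inner product of
    frame components.

    A horospherical field has components (cos u, sin u, 0).  Its derivative
    along xi_i is z u_i times the rotated vector (- sin u, cos u, 0), which
    contributes z^2 u_i^2 to the bending, plus a vertical component y_i,
    which contributes cos^2 u + sin^2 u = 1 in total; this is the bending
    formula (bending_angle_field).  Differentiating once more and taking the
    trace gives (rough_laplacian_angle_field)
      nabla^* nabla sigma = |nabla sigma|^2 sigma
        + (Delta u) (- sin u, cos u, 0)
        + 2 z (u_x sin u - u_y cos u) (0, 0, 1)
    in frame components.  The last two terms are orthogonal to sigma and to
    each other, so sigma is harmonic exactly when both coefficients vanish.
    The angles are only local, but all the operators are local too, so the
    computation may be done on each open set that carries an angle. *)

(** * Coordinates and directional derivatives *)

Lemma sum_ord3 (V : nmodType) (F : 'I_3 -> V) :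
  \sum_i F i = F 0 + F 1 + F 2.
Proof.
rewrite !big_ord_recl big_ord0 addr0 addrA.
by congr (F _ + F _ + F _); exact: val_inj.
Qed.

Lemma ord3_ind (P : 'I_3 -> Prop) : P 0 -> P 1 -> P 2 -> forall i, P i.
Proof.
move=> P0 P1 P2 [[|[|[|//]]] lt_i3].
- by rewrite (_ : Ordinal _ = 0)//; exact: val_inj.
- by rewrite (_ : Ordinal _ = 1)//; exact: val_inj.
- by rewrite (_ : Ordinal _ = 2)//; exact: val_inj.
Qed.

(** Naming the partial derivatives before normalizing prevents the ring
    decision procedure from unfolding limits when it compares atoms. *)
Ltac generalize_partials :=
  repeat match goal with
  | |- context [partial ?i ?f ?p] => generalize (partial i f p); intro
  end; rewrite /=.

Lemma is_derive_coord (R : realType) (j : 'I_3) (p v : 'rV[R]_3) :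
  is_derive p v (fun q => q 0 j) (v 0 j).
Proof.
have idp : derivable (id : 'rV[R]_3 -> 'rV[R]_3) p v by exact: derivable_id.
apply: DeriveDef; first exact: ((derivable_mxP _ _ _).1 idp 0 j).
by have := derive_mx idp; rewrite derive_id => /matrixP/(_ 0 j); rewrite mxE.
Qed.

(** The chain rule for functions known to be derivable only in the direction
    of v: both sides are derivatives along the line through p, where the
    one-variable chain rule applies.  Smoothness expressed by partial
    derivatives gives this directional form without passing through total
    differentiability. *)
Lemma is_derive_comp_line (R : realType) (V : normedModType R) (g : R -> R)
    (f : V -> R) (p v : V) (df dg : R) :
  is_derive p v f df -> is_derive (f p) 1 g dg ->
  is_derive p v (fun q => g (f q)) (dg * df).
Proof.
move=> [fp <-] gp.
have line (h : V -> R) : 'D_v h p = 'D_1 (fun t : R => h (t *: v + p)) 0.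
  rewrite /derive; set g1 := fun t => t^-1 *: _; set g2 := fun t => t^-1 *: _.
  suff -> : g1 = g2 by [].
  by apply/funext => t; rewrite /g1 /g2 /= addr0 scale0r add0r [t%:A]mulr1.
have fl : is_derive (0 : R) 1 (fun t : R => f (t *: v + p)) ('D_v f p).
  by rewrite line; apply: derivableP; exact: ((derivable1P _ _ _).1 fp).
have gl : is_derive (f (0 *: v + p)) 1 g dg by rewrite scale0r add0r.
have [gfp gfE] := @is_derive1_comp _ _ _ _ _ _ gl fl.
by apply: DeriveDef; [exact: ((derivable1P _ _ _).2 gfp) | rewrite line; exact: gfE].
Qed.

Lemma is_derive_mul (R : realType) (V : normedModType R) (f g : V -> R)
    (p v : V) (df dg : R) :
  is_derive p v f df -> is_derive p v g dg ->
  is_derive p v (fun q => f q * g q) (f p * dg + g p * df).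
Proof. by move=> fp gp; exact: is_deriveM. Qed.

Lemma is_derive_cos_comp (R : realType) (V : normedModType R)
    (f : V -> R) (p v : V) (df : R) :
  is_derive p v f df -> is_derive p v (fun q => cos (f q)) (- (sin (f p) * df)).
Proof.
by move=> fp; rewrite -mulNr; exact: (is_derive_comp_line fp (is_derive_cos _)).
Qed.

Lemma is_derive_sin_comp (R : realType) (V : normedModType R)
    (f : V -> R) (p v : V) (df : R) :
  is_derive p v f df -> is_derive p v (fun q => sin (f q)) (cos (f p) * df).
Proof.
by move=> fp; exact: (is_derive_comp_line fp (is_derive_sin _)).
Qed.

Lemma is_derive_height (R : realType) (i : 'I_3) (p : 'rV[R]_3) :
  is_derive p (coord_vec i) (fun q => q 0 2) (i == 2)%:R.
Proof.
by apply: (is_derive_eq (is_derive_coord _ _ _)); rewrite mxE eqxx eq_sym.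
Qed.

Lemma smooth_is_derive (R : realType) (W : set 'rV[R]_3) (u : 'rV[R]_3 -> R)
    (i : 'I_3) (p : 'rV[R]_3) : smooth_on W u -> W p ->
  is_derive p (coord_vec i) u (partial i u p).
Proof. by move=> su Wp; apply: derivableP; have [_] := su [::] p Wp; exact. Qed.

Lemma smooth_is_derive2 (R : realType) (W : set 'rV[R]_3) (u : 'rV[R]_3 -> R)
    (i j : 'I_3) (p : 'rV[R]_3) : smooth_on W u -> W p ->
  is_derive p (coord_vec i) (partial j u) (partial i (partial j u) p).
Proof. by move=> su Wp; apply: derivableP; have [_] := su [:: j] p Wp; exact. Qed.

(** * The connection in the standard frame *)

Lemma partial_metric (R : realType) (i j k : 'I_3) (p : 'rV[R]_3) :
  0 < p 0 2 ->
  partial i (fun q => hyp_metric q j k) p =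
  - 2 * (j == k)%:R * (i == 2)%:R * (p 0 2) ^- 3.
Proof.
move=> p_gt0; have p_neq0 : p 0 2 != 0 by rewrite gt_eqF.
pose h : 'rV[R]_3 -> R := fun q => q 0 2.
have [hd hE] : is_derive p (coord_vec i) h (i == 2)%:R by exact: is_derive_height.
have hd2 : derivable (h ^+ 2) p (coord_vec i) by exact: derivableX.
have h2_neq0 : (h ^+ 2) p != 0 by rewrite exprfctE expf_neq0.
have -> : (fun q => hyp_metric q j k) =
    (j == k)%:R \*o (fun q : 'rV[R]_3 => ((h ^+ 2) q)^-1).
  by apply/funext => q /=; rewrite !mxE exprfctE mulr_natl.
rewrite /partial deriveMl; last exact: derivableV.
rewrite deriveV// deriveX// hE exprfctE /h /= expr1 /GRing.scale /=.
by field.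
Qed.

(** For the conformal metric e^(2 phi) times the Euclidean one, the symbols are
    [j = k] d_i phi + [i = k] d_j phi - [i = j] d_k phi; here phi = - ln z,
    whose only nonzero derivative is - 1/z in the direction of index 2. *)
Lemma christoffelE (R : realType) (i j k : 'I_3) (p : 'rV[R]_3) :
  0 < p 0 2 ->
  christoffel k i j p = - (p 0 2)^-1 *
    ((j == k)%:R * (i == 2)%:R + (i == k)%:R * (j == 2)%:R
     - (i == j)%:R * (k == 2)%:R).
Proof.
move=> p_gt0; have p_neq0 : p 0 2 != 0 by rewrite gt_eqF.
rewrite /christoffel /hyp_metric invmx_scalar invrK.
rewrite (bigD1 k)//= big1 => [|l lk]; last first.
  by rewrite mxE eq_sym (negbTE lk) mulr0n mul0r.
by rewrite !partial_metric// mxE eqxx mulr1n addr0; field.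
Qed.

Definition frame_field {R : realType} (y : 'I_3 -> 'rV[R]_3 -> R)
    (p : 'rV[R]_3) : 'rV[R]_3 :=
  \row_k (p 0 2 * y k p).

Lemma frame_field_eq0 (R : realType) (y : 'I_3 -> 'rV[R]_3 -> R)
    (p : 'rV[R]_3) : 0 < p 0 2 ->
  frame_field y p = 0 <-> (forall k, y k p = 0).
Proof.
move=> p_gt0; split=> [/rowP y0 k|y0]; last first.
  by apply/rowP => k; rewrite !mxE y0 mulr0.
by have /eqP := y0 k; rewrite !mxE mulf_eq0 gt_eqF//= => /eqP.
Qed.

Lemma xi_frame (R : realType) (i : 'I_3) (p : 'rV[R]_3) :
  xi i p = frame_field (fun k _ => (i == k)%:R) p.
Proof. by apply/rowP => k; rewrite !mxE eq_sym. Qed.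

Lemma hyp_grad_frame (R : realType) (u : 'rV[R]_3 -> R) (p : 'rV[R]_3) :
  hyp_grad u p = frame_field (fun k q => q 0 2 * partial k u q) p.
Proof.
apply/rowP => k; rewrite !mxE /hyp_metric invmx_scalar invrK.
rewrite (bigD1 k)//= big1 => [|l lk]; last first.
  by rewrite mxE eq_sym (negbTE lk) mul0r.
by rewrite mxE eqxx mulr1n addr0 expr2 mulrA.
Qed.

Lemma hyp_inner_frame (R : realType) (a b : 'I_3 -> 'rV[R]_3 -> R)
    (p : 'rV[R]_3) : 0 < p 0 2 ->
  hyp_inner p (frame_field a p) (frame_field b p) = \sum_k a k p * b k p.
Proof.
move=> p_gt0; apply: eq_bigr => i _; have p_neq0 : p 0 2 != 0 by rewrite gt_eqF.
rewrite (bigD1 i)//= big1 => [|l li]; last first.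
  by rewrite mxE eq_sym (negbTE li) !mul0r.
by rewrite !mxE eqxx mulr1n; field.
Qed.

(** The frame components of the covariant derivative along xi i of the field
    with frame components y; see cov_deriv_frame. *)
Definition frame_deriv {R : realType} (i : 'I_3) (y : 'I_3 -> 'rV[R]_3 -> R)
    (k : 'I_3) (p : 'rV[R]_3) : R :=
  p 0 2 * partial i (y k) p - (i == k)%:R * y 2 p + (k == 2)%:R * y i p.

Lemma sum_xi (R : realType) (i : 'I_3) (p : 'rV[R]_3) (F : 'I_3 -> R) :
  \sum_l xi i p 0 l * F l = p 0 2 * F i.
Proof.
rewrite (bigD1 i)//= big1 => [|l li]; last first.
  by rewrite !mxE (negbTE li) andbF mulr0 mul0r.
by rewrite !mxE !eqxx mulr1 addr0.
Qed.

(** The derivative of the factor z in z y_k produces [i = z] y_k, which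
    cancels one of the three Christoffel terms; only two terms of order zero
    remain, and their coefficients are constant. *)
Lemma cov_deriv_frame (R : realType) (W : set 'rV[R]_3) (i : 'I_3)
    (Y : 'rV[R]_3 -> 'rV[R]_3) (y : 'I_3 -> 'rV[R]_3 -> R) (p : 'rV[R]_3) :
  open W -> W p -> 0 < p 0 2 ->
  (forall q, W q -> Y q = frame_field y q) ->
  (forall k, derivable (y k) p (coord_vec i)) ->
  cov_deriv (xi i) Y p = frame_field (frame_deriv i y) p.
Proof.
move=> oW Wp p_gt0 Yy dy; have p_neq0 : p 0 2 != 0 by rewrite gt_eqF.
have YE k : partial i (fun q => Y q 0 k) p =
    p 0 2 * partial i (y k) p + y k p * (i == 2)%:R.
  rewrite /partial.
  (* Y is given by its frame components only near p. *)
  rewrite (@near_eq_derive _ _ _ _ ((fun q : 'rV[R]_3 => q 0 2 : R) * y k)); last first.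
    near=> q; rewrite Yy ?mxE//; near: q; exact: open_nbhs_nbhs.
  have [hd hE] := is_derive_height i p.
  by rewrite deriveM// hE.
apply/rowP => k; rewrite !mxE.
rewrite sum_xi YE /frame_deriv; congr (_ * _).
rewrite sum_ord3 !christoffelE// !Yy// !mxE -!addrA; congr (_ + _).
by move: i k {dy YE} => + k; apply: ord3_ind; move: k; apply: ord3_ind;
  rewrite /=; field.
Unshelve. all: by end_near. Qed.

(** A covariant derivative is tensorial in its direction, so its value depends
    on that direction at p alone. *)
Lemma cov_deriv_scale_xi (R : realType) (X Y : 'rV[R]_3 -> 'rV[R]_3)
    (c : R) (j : 'I_3) (p : 'rV[R]_3) :
  X p = c *: xi j p -> cov_deriv X Y p = c *: cov_deriv (xi j) Y p.
Proof.
move=> Xp; apply/rowP => k; rewrite !mxE mulr_sumr; apply: eq_bigr => i _.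
by rewrite Xp mxE mulrA.
Qed.

(** The vertical geodesics are integral curves of xi 2, while the horizontal
    frame fields bend upwards because horospheres have mean curvature one. *)
Lemma cov_deriv_xi_xi (R : realType) (i : 'I_3) (p : 'rV[R]_3) :
  0 < p 0 2 -> cov_deriv (xi i) (xi i) p = (i != 2)%:R *: xi 2 p.
Proof.
move=> p_gt0.
rewrite (@cov_deriv_frame _ setT i _ (fun k => cst (i == k)%:R))//.
- apply/rowP => k; rewrite !mxE /frame_deriv /partial derive_cst /=.
  by move: i k; apply: ord3_ind; apply: ord3_ind => /=; ring.
- exact: openT.
- by move=> q _; exact: xi_frame.
Qed.

Lemma bending_frame (R : realType) (W : set 'rV[R]_3)
    (Y : 'rV[R]_3 -> 'rV[R]_3)
    (w : 'I_3 -> 'I_3 -> 'rV[R]_3 -> R) (p : 'rV[R]_3) : W p -> 0 < p 0 2 ->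
  (forall i q, W q -> cov_deriv (xi i) Y q = frame_field (w i) q) ->
  bending Y p = \sum_i \sum_k w i k p ^+ 2.
Proof.
move=> Wp p_gt0 Yw; apply: eq_bigr => i _.
by rewrite Yw// /hyp_sqnorm hyp_inner_frame//; apply: eq_bigr.
Qed.

(** The two horizontal directions each have nabla_{xi_i} xi_i = xi_2, whence
    the correction 2 (w 2 k) to the plain second derivatives.  Prescribing the
    components w of the first derivative on a neighbourhood is what allows
    differentiating them again. *)
Lemma rough_laplacian_frame (R : realType) (W : set 'rV[R]_3)
    (Y : 'rV[R]_3 -> 'rV[R]_3)
    (w : 'I_3 -> 'I_3 -> 'rV[R]_3 -> R) (p : 'rV[R]_3) :
  open W -> W p -> 0 < p 0 2 ->
  (forall i q, W q -> cov_deriv (xi i) Y q = frame_field (w i) q) ->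
  (forall i k, derivable (w i k) p (coord_vec i)) ->
  rough_laplacian Y p = frame_field
    (fun k q => 2 * w 2 k q - \sum_i frame_deriv i (w i) k q) p.
Proof.
move=> oW Wp p_gt0 Yw dw; rewrite /rough_laplacian /cov_deriv2.
under eq_bigr => i _.
  rewrite (cov_deriv_frame oW Wp p_gt0 (Yw i) (dw i)).
  rewrite (cov_deriv_scale_xi _ (cov_deriv_xi_xi i p_gt0)) Yw//.
  over.
apply/rowP => k; rewrite !mxE !sum_ord3 !mxE /=; ring.
Qed.

(** The trace of the frame derivative of z d_k u: the derivative of z adds one
    copy of z d_z u and the two horizontal directions subtract one each. *)
Lemma hyp_laplacianE (R : realType) (W : set 'rV[R]_3) (u : 'rV[R]_3 -> R)
    (p : 'rV[R]_3) : smooth_on W u -> W p -> 0 < p 0 2 ->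
  hyp_laplacian u p =
  - ((p 0 2) ^+ 2 * (\sum_i partial i (partial i u) p) - p 0 2 * partial 2 u p).
Proof.
move=> su Wp p_gt0; rewrite /hyp_laplacian; congr (- _).
have du i k : is_derive p (coord_vec i) (fun q => q 0 2 * partial k u q)
    (p 0 2 * partial i (partial k u) p + partial k u p * (i == 2)%:R).
  by apply: is_derive_mul; [exact: is_derive_height | exact: smooth_is_derive2 su Wp].
have divE i : hyp_inner p (cov_deriv (xi i) (hyp_grad u) p) (xi i p) =
    frame_deriv i (fun k q => q 0 2 * partial k u q) i p.
  rewrite (@cov_deriv_frame _ setT _ _ (fun k q => q 0 2 * partial k u q))//.
  - rewrite xi_frame hyp_inner_frame// (bigD1 i)//= big1 => [|l li].
      by rewrite eqxx mulr1 addr0.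
    by rewrite eq_sym (negbTE li) mulr0.
  - exact: openT.
  - by move=> q _; exact: hyp_grad_frame.
have dE i k : partial i (fun q => q 0 2 * partial k u q) p =
    p 0 2 * partial i (partial k u) p + partial k u p * (i == 2)%:R.
  by have [_] := du i k.
rewrite /hyp_div !sum_ord3 !divE /frame_deriv !dE.
by generalize_partials; ring.
Qed.

(** * Horospherical fields *)

Definition angle_field {R : realType} (u : 'rV[R]_3 -> R) (k : 'I_3)
    (q : 'rV[R]_3) : R :=
  if k == 0 then cos (u q) else if k == 1 then sin (u q) else 0.

(** The simplified form of frame_deriv i (angle_field u): the factor z d_i
    acts on the angle, and the connection adds the vertical component y_i. *)
Definition angle_field_deriv {R : realType} (u : 'rV[R]_3 -> R) (i k : 'I_3)
    (q : 'rV[R]_3) : R :=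
  if k == 0 then q 0 2 * - (sin (u q) * partial i u q)
  else if k == 1 then q 0 2 * (cos (u q) * partial i u q)
  else angle_field u i q.

Lemma is_derive_angle_field (R : realType) (W : set 'rV[R]_3)
    (u : 'rV[R]_3 -> R) (i k : 'I_3) (p : 'rV[R]_3) :
  smooth_on W u -> W p ->
  is_derive p (coord_vec i) (angle_field u k)
    (if k == 0 then - (sin (u p) * partial i u p)
     else if k == 1 then cos (u p) * partial i u p else 0).
Proof.
move=> su Wp; have ui := smooth_is_derive i su Wp.
move: k; apply: ord3_ind; rewrite /angle_field /=.
- exact: is_derive_cos_comp.
- exact: is_derive_sin_comp.
- exact: is_derive_cst.
Qed.

Lemma cov_deriv_angle_field (R : realType) (W : set 'rV[R]_3)
    (Y : 'rV[R]_3 -> 'rV[R]_3) (u : 'rV[R]_3 -> R) (i : 'I_3) (p : 'rV[R]_3) :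
  open W -> W p -> 0 < p 0 2 -> smooth_on W u ->
  (forall q, W q -> Y q = frame_field (angle_field u) q) ->
  cov_deriv (xi i) Y p = frame_field (angle_field_deriv u i) p.
Proof.
move=> oW Wp p_gt0 su Yu.
have du k := is_derive_angle_field i k su Wp.
have duE k := @derive_val _ _ _ _ _ _ _ (du k).
rewrite (cov_deriv_frame oW Wp p_gt0 Yu); last by move=> k; have [] := du k.
apply/rowP => k; rewrite !mxE; congr (_ * _).
rewrite /frame_deriv /partial duE {du duE}.
move: k; apply: ord3_ind; rewrite /angle_field_deriv /angle_field /=; ring.
Qed.

Lemma is_derive_angle_field_deriv (R : realType) (W : set 'rV[R]_3)
    (u : 'rV[R]_3 -> R) (i k : 'I_3) (p : 'rV[R]_3) :
  smooth_on W u -> W p ->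
  is_derive p (coord_vec i) (angle_field_deriv u i k)
    (if k == 0 then
       - (p 0 2 * (sin (u p) * partial i (partial i u) p
                   + cos (u p) * partial i u p ^+ 2)
          + (i == 2)%:R * (sin (u p) * partial i u p))
     else if k == 1 then
       p 0 2 * (cos (u p) * partial i (partial i u) p
                - sin (u p) * partial i u p ^+ 2)
       + (i == 2)%:R * (cos (u p) * partial i u p)
     else if i == 0 then - (sin (u p) * partial i u p)
     else if i == 1 then cos (u p) * partial i u p else 0).
Proof.
move=> su Wp; have ui := smooth_is_derive i su Wp.
have uii := smooth_is_derive2 i i su Wp.
have hi := is_derive_height i p.
move: k; apply: ord3_ind; rewrite /angle_field_deriv /=.
- apply: is_derive_eq.
    apply: (is_derive_mul hi); apply: is_deriveN.
    exact: (is_derive_mul (is_derive_sin_comp ui) uii).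
  by rewrite /=; ring.
- apply: is_derive_eq.
    apply: (is_derive_mul hi).
    exact: (is_derive_mul (is_derive_cos_comp ui) uii).
  by rewrite /=; ring.
- exact: (is_derive_angle_field i i su Wp).
Qed.

(** The six horizontal squares add up to (cos^2 u + sin^2 u) |nabla u|^2 and
    the vertical ones to cos^2 u + sin^2 u. *)
Lemma bending_angle_field (R : realType) (W : set 'rV[R]_3)
    (Y : 'rV[R]_3 -> 'rV[R]_3) (u : 'rV[R]_3 -> R) (p : 'rV[R]_3) :
  open W -> W p -> W `<=` H3 -> smooth_on W u ->
  (forall q, W q -> Y q = frame_field (angle_field u) q) ->
  bending Y p = 1 + hyp_sqnorm p (hyp_grad u p).
Proof.
move=> oW Wp WH su Yu; have p_gt0 := WH _ Wp.
have DY i q (Wq : W q) := cov_deriv_angle_field i oW Wq (WH _ Wq) su Yu.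
rewrite (bending_frame Wp p_gt0 DY).
rewrite /hyp_sqnorm hyp_grad_frame hyp_inner_frame// !sum_ord3.
rewrite /angle_field_deriv /angle_field /=.
have := cos2Dsin2 (u p); move: (cos _) (sin _) => c s cs1.
transitivity ((c ^+ 2 + s ^+ 2) *
  (1 + \sum_i (p 0 2 * partial i u p) ^+ 2)); rewrite sum_ord3; last rewrite cs1;
  by generalize_partials; ring.
Qed.

(** The second term is the part of the rough Laplacian orthogonal to Y: its
    horizontal part is Delta u times the rotated unit vector, and its vertical
    component is - 2 times the derivative of u along that rotated vector. *)
Lemma rough_laplacian_angle_field (R : realType) (W : set 'rV[R]_3)
    (Y : 'rV[R]_3 -> 'rV[R]_3) (u : 'rV[R]_3 -> R) (p : 'rV[R]_3) :
  open W -> W p -> W `<=` H3 -> smooth_on W u ->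
  (forall q, W q -> Y q = frame_field (angle_field u) q) ->
  rough_laplacian Y p = bending Y p *: Y p + frame_field (fun k q =>
    if k == 0 then - (sin (u q) * hyp_laplacian u q)
    else if k == 1 then cos (u q) * hyp_laplacian u q
    else 2 * q 0 2 *
      (partial 0 u q * sin (u q) - partial 1 u q * cos (u q))) p.
Proof.
move=> oW Wp WH su Yu; have p_gt0 := WH _ Wp.
have DY i q (Wq : W q) := cov_deriv_angle_field i oW Wq (WH _ Wq) su Yu.
have dw i k := is_derive_angle_field_deriv i k su Wp.
have dwE i k := @derive_val _ _ _ _ _ _ _ (dw i k).
rewrite (rough_laplacian_frame oW Wp p_gt0 DY); last first.
  by move=> i k; have [] := dw i k.
rewrite (bending_angle_field oW Wp WH su Yu) (Yu _ Wp).
rewrite /hyp_sqnorm hyp_grad_frame hyp_inner_frame//.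
apply/rowP => k; rewrite !mxE (hyp_laplacianE su Wp p_gt0) !sum_ord3.
rewrite /frame_deriv.
have pE i l : partial i (angle_field_deriv u i l) p = _ := dwE i l.
rewrite !pE {pE dwE dw}.
move: k; apply: ord3_ind; rewrite /angle_field_deriv /angle_field;
  generalize_partials; ring.
Qed.

Lemma sin_cos_eq0 (R : realType) (x a : R) :
  sin x * a = 0 -> cos x * a = 0 -> a = 0.
Proof.
move=> sa ca; rewrite -[a]mul1r -(cos2Dsin2 x) mulrDl !expr2 -!mulrA.
by rewrite sa ca !mulr0 addr0.
Qed.

Theorem proposition2 (R : realType) (M : set 'rV[R]_3)
    (sigma : 'rV[R]_3 -> 'rV[R]_3)
    (I : Type) (U : I -> set 'rV[R]_3) (u : I -> 'rV[R]_3 -> R)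
    (hM : is_domain M)
    (hsigma : horospherical_unit_field M sigma)
    (hform : standard_form M sigma U u) :
  (forall (i : I) (p : 'rV[R]_3), U i p ->
     bending sigma p = 1 + hyp_sqnorm p (hyp_grad (u i) p)) /\
  (harmonic_unit_field M sigma <->
   (forall (i : I) (p : 'rV[R]_3), U i p ->
      hyp_laplacian (u i) p = 0 /\
      partial 0 (u i) p * sin (u i p) = partial 1 (u i) p * cos (u i p))).
Proof.
case: hM hsigma hform => MH _ _ _ [smooth_sigma _] [MU oU su sigmaE].
have UH i : U i `<=` H3 by move=> p Up; apply: MH; rewrite MU; exists i.
have sigma_angle i q : U i q -> sigma q = frame_field (angle_field (u i)) q.
  move=> Uq; rewrite (sigmaE i q Uq); apply/rowP => k; rewrite !mxE /angle_field.
  by move: k; apply: ord3_ind => /=; ring.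
split=> [i p Up|].
  exact: (bending_angle_field (oU i) Up (UH i) (su i) (sigma_angle i)).
have roughE i p (Up : U i p) := rough_laplacian_angle_field
  (oU i) Up (UH i) (su i) (sigma_angle i).
split=> [[_ harm] i p Up|eqs].
- have Mp : M p by rewrite MU; exists i.
  have p_neq0 : p 0 2 != 0 by rewrite gt_eqF// (UH i).
  have /eqP := harm p Mp.
  rewrite (roughE i p Up) -subr_eq0 [X in X - _]addrC addrK.
  move=> /eqP/(frame_field_eq0 _ (UH i p Up)) tanE.
  (* The rotated vector does not vanish: one of sin u and cos u is nonzero. *)
  have sL : sin (u i p) * hyp_laplacian (u i) p = 0.
    by apply: oppr_inj; rewrite oppr0; exact: (tanE 0).
  have cL : cos (u i p) * hyp_laplacian (u i) p = 0 by exact: (tanE 1).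
  split; first exact: sin_cos_eq0 sL cL.
  have /eqP := tanE 2; rewrite /= !mulf_eq0 (negbTE p_neq0) pnatr_eq0 /=.
  by rewrite subr_eq0 => /eqP.
- split=> // p; rewrite MU => -[i _ Up].
  rewrite (roughE i p Up) [X in _ + X](_ : _ = 0) ?addr0//.
  have [L0 /eqP] := eqs i p Up; rewrite -subr_eq0 => /eqP uxy0.
  apply/(frame_field_eq0 _ (UH i p Up)) => k.
  by rewrite L0 uxy0 !mulr0 oppr0 !if_same.
Qed.
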